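(* Let $n,x\ge 0$ be fixed integers, let $\alpha\in\mathbb{C}$ and $p\in(0,1)$ be fixed, and put $q=\frac{1-p}{p}$. For integers $N\ge\max(n,x)$ put $$\xi=\alpha+1-N+(1+q)x .$$ Then $$\binom{N}{n}K_n(x;p,N)=L_n^{(\alpha)}(\xi)+\mathcal{O}\left(N^{n-1}\right),\qquad N\to\infty .$$
   Context: The Krawtchouk polynomials $K_n(x;p,N)$ are defined, for $n=0,1,\ldots,N$ and $x\in\{0,1,\ldots,N\}$, by the generating function $$(1-qw)^{x}(1+w)^{N-x}=\sum_{n=0}^N\binom{N}{n}K_n(x;p,N)\,w^n,\qquad q=\frac{1-p}{p}.$$ The Laguerre polynomials $L_n^{(\alpha)}(x)$ are defined, for $\alpha,x\in\mathbb{C}$, by $$(1-w)^{-\alpha-1}e^{-wx/(1-w)}=\sum_{n=0}^\infty L_n^{(\alpha)}(x)\,w^n,\qquad |w|<1.$$ *)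

(* Defs.v *)
From Stdlib Require Import Reals ZArith.
From Coquelicot Require Import Coquelicot.

Open Scope R_scope.

(* [(1 - q w)^x (1 + w)^(N-x) = sum_(n <= N) binom(N,n) K_n(x;p,N) w^n]; as an
   identity in all real [w] it determines [K n x p N] for [n, x <= N], and leaves
   the other values of [K] unconstrained. *)
Definition is_krawtchouk (K : nat -> nat -> R -> nat -> R) : Prop :=
  forall (p : R) (N x : nat), p <> 0 -> (x <= N)%nat ->
  forall w : R,
    (1 - (1 - p) / p * w) ^ x * (1 + w) ^ (N - x) =
    sum_f_R0 (fun n => Binomial.C N n * K n x p N * w ^ n) N.

Definition Cexp (z : C) : C :=
  (exp (Re z) * cos (Im z), exp (Re z) * sin (Im z)).

(* Principal logarithm on the half-plane [0 < Re z], the only place where it is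
   used: [Cmod w < 1] implies [0 < Re (1 - w)]. *)
Definition Clog_right (z : C) : C :=
  (ln (Cmod z), atan (Im z / Re z)).

Definition Cpower_right (z a : C) : C := Cexp (a * Clog_right z)%C.

(* [L n alpha x] stands for [L_n^(alpha)(x)]. *)
Definition is_laguerre (L : nat -> C -> C -> C) : Prop :=
  forall alpha x w : C, Cmod w < 1 ->
    is_series (K := C_AbsRing) (V := C_NormedModule)
      (fun n : nat => (L n alpha x * w ^ n)%C)
      (Cpower_right (1 - w) (- alpha - 1) * Cexp (- w * x / (1 - w)))%C.

Definition is_bigO (u : nat -> C) (v : nat -> R) : Prop :=
  exists M : R, eventually (fun N : nat => Cmod (u N) <= M * Rabs (v N)).

(* Main.v *)
Require Import Defs.
From Stdlib Require Import Reals ZArith Lra Lia.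
From Coquelicot Require Import Coquelicot.

Open Scope R_scope.

(* Both generating functions satisfy an equation
   [(1 + c1 w + c2 w^2) g' = (d0 + d1 w) g]: for Krawtchouk
   [c = (1 - q, -q)], [d1 = -qN]; for Laguerre [c = (-2, 1)],
   [d1 = -(alpha + 1)]; and the choice of [xi] makes
   [d0 = N - (1 + q) x] in both cases. Comparing coefficients gives
     (k + 2) u_(k+2) + c1 (k + 1) u_(k+1) + c2 k u_k = d0 u_(k+1) + d1 u_k
   with [d1 = O(N)], so by induction on [k] each family is
   [N^k / k! + O(N^(k-1))], and the leading terms cancel. *)

(** * Power series and linear differential equations *)

(** Convergence at a point [v] strictly between [Rabs w] and [r] forces the terms there to tend to
    0, which fails outside the disk of convergence. *)
Lemma pseries_interior (a : nat -> R) (g : R -> R) (r w : R)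
  (Ha : forall v, Rabs v < r -> is_pseries a v (g v)) (Hw : Rabs w < r) :
  Rbar_lt (Rabs w) (CV_radius a).
Proof.
  set (v := (Rabs w + r) / 2).
  assert (Hwv : Rabs w < v) by (unfold v; lra).
  assert (Hv : Rabs v = v) by (apply Rabs_pos_eq; pose proof (Rabs_pos w); lra).
  destruct (Rbar_lt_le_dec (CV_radius a) (Rabs v)) as [Hlt | Hle].
  - exfalso. apply (CV_disk_outside a v Hlt).
    apply ex_series_lim_0. exists (g v). apply is_pseries_R, Ha.
    rewrite Hv. unfold v. lra.
  - apply Rbar_lt_le_trans with (2 := Hle). simpl. lra.
Qed.

(** Near [w] the function [g] coincides with [PSeries a], which can be differentiated termwise
    inside the disk; uniqueness of the derivative identifies the sum with [l]. *)
Lemma is_pseries_derive (a : nat -> R) (g : R -> R) (r w l : R)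
  (Ha : forall v, Rabs v < r -> is_pseries a v (g v)) (Hw : Rabs w < r)
  (Hg : is_derive g w l) :
  is_pseries (PS_derive a) w l.
Proof.
  pose proof (pseries_interior a g r w Ha Hw) as Hr.
  assert (Hl : PSeries (PS_derive a) w = l).
  { rewrite <- (is_derive_unique _ _ _ (is_derive_PSeries a w Hr)).
    apply is_derive_unique.
    apply is_derive_ext_loc with (2 := Hg).
    assert (Hd : 0 < r - Rabs w) by lra.
    exists (mkposreal _ Hd). intros v Hv.
    symmetry. apply is_pseries_unique, Ha.
    change (Rabs (v - w) < r - Rabs w) in Hv.
    pose proof (Rabs_triang_inv v w) as Ht. lra. }
  rewrite <- Hl. apply PSeries_correct, CV_radius_inside.
  now rewrite CV_radius_derive.
Qed.

(** The sum near 0 determines the coefficients, so comparison with the zero series suffices. *)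
Lemma pseries_zero (a : nat -> R) (r : R) (Hr : 0 < r)
  (Ha : forall w, Rabs w < r -> is_pseries a w 0) (n : nat) : a n = 0.
Proof.
  assert (H0 : Rabs 0 < r) by (now rewrite Rabs_R0).
  assert (Hz : forall w, Rabs w < r -> is_pseries (fun _ : nat => 0) w 0).
  { intros w _. apply is_pseries_R.
    apply is_series_ext with (fun _ => 0); [intros; symmetry; apply Rmult_0_l |].
    unfold is_series. apply filterlim_ext with (fun _ => 0).
    - intros k. rewrite sum_n_const. symmetry. apply Rmult_0_r.
    - apply filterlim_const. }
  apply (PSeries_ext_recip a (fun _ => 0)).
  - rewrite <- Rabs_R0 at 1. now apply (pseries_interior a (fun _ => 0) r).
  - rewrite <- Rabs_R0 at 1. now apply (pseries_interior _ (fun _ => 0) r).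
  - exists (mkposreal r Hr). intros w Hw.
    change (Rabs (w - 0) < r) in Hw. rewrite Rminus_0_r in Hw.
    rewrite (is_pseries_unique _ _ _ (Ha w Hw)).
    symmetry. apply is_pseries_unique, Hz, Hw.
Qed.

(* [h] is there because the real and imaginary parts of a complex equation are
   coupled. *)
Lemma pseries_ode_recurrence (a b : nat -> R) (g h dg : R -> R)
  (r c1 c2 d0 d1 e0 e1 : R) (Hr : 0 < r)
  (Ha : forall w, Rabs w < r -> is_pseries a w (g w))
  (Hb : forall w, Rabs w < r -> is_pseries b w (h w))
  (Hg : forall w, Rabs w < r -> is_derive g w (dg w))
  (Hode : forall w, Rabs w < r ->
     (1 + c1 * w + c2 * w * w) * dg w =
     (d0 + d1 * w) * g w + (e0 + e1 * w) * h w) :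
  a 1%nat = d0 * a O + e0 * b O /\
  forall k : nat,
    (INR k + 2) * a (S (S k)) + c1 * (INR k + 1) * a (S k) + c2 * INR k * a k =
    d0 * a (S k) + d1 * a k + e0 * b (S k) + e1 * b k.
Proof.
  pose (D := PS_derive a).
  (* Coefficients of [(1 + c1 w + c2 w^2) g' - (d0 + d1 w) g - (e0 + e1 w) h]; multiplication by [w]
     is the shift [PS_incr_1]. *)
  pose (t := PS_plus (PS_plus D
        (PS_incr_1 (PS_plus (PS_scal c1 D) (PS_incr_1 (PS_scal c2 D)))))
        (PS_plus
          (PS_plus (PS_scal (-d0) a) (PS_incr_1 (PS_scal (-d1) a)))
          (PS_plus (PS_scal (-e0) b) (PS_incr_1 (PS_scal (-e1) b))))).
  assert (Ht : forall n, t n = 0).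
  { apply (pseries_zero t r Hr). intros w Hw.
    pose proof (is_pseries_derive a g r w (dg w) Ha Hw (Hg w Hw)) as HD.
    fold D in HD.
    replace 0 with
     (plus (plus (dg w) (scal w (plus (scal c1 (dg w)) (scal w (scal c2 (dg w))))))
       (plus (plus (scal (-d0) (g w)) (scal w (scal (-d1) (g w))))
             (plus (scal (-e0) (h w)) (scal w (scal (-e1) (h w)))))).
    - unfold t.
      repeat match goal with
      | |- is_pseries (PS_plus _ _) _ _ => apply @is_pseries_plus
      | |- is_pseries (PS_incr_1 _) _ _ => apply @is_pseries_incr_1
      | |- is_pseries (PS_scal _ _) _ _ => apply @is_pseries_scal; [apply Rmult_comm |]
      end; auto.
    - pose proof (Hode w Hw).
      change (dg w + w * (c1 * dg w + w * (c2 * dg w)) +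
        (- d0 * g w + w * (- d1 * g w) + (- e0 * h w + w * (- e1 * h w))) = 0).
      lra. }
  split.
  - specialize (Ht O).
    change (1 * a 1%nat + 0 + (- d0 * a O + 0 + (- e0 * b O + 0)) = 0) in Ht.
    lra.
  - intros k. specialize (Ht (S k)).
    assert (HS : t (S k) = INR (S (S k)) * a (S (S k)) +
        (c1 * (INR (S k) * a (S k)) + c2 * (INR k * a k)) +
        (- d0 * a (S k) + - d1 * a k + (- e0 * b (S k) + - e1 * b k))).
    (* At [k = 0] the doubly shifted term is 0 by definition of the shift; the factor [INR k] makes
       the general formula agree. *)
    { destruct k as [|k]; [|reflexivity].
      change (INR 2 * a 2%nat + (c1 * (INR 1 * a 1%nat) + 0) +
        (- d0 * a 1%nat + - d1 * a O + (- e0 * b 1%nat + - e1 * b O)) =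
        INR 2 * a 2%nat + (c1 * (INR 1 * a 1%nat) + c2 * (0 * a O)) +
        (- d0 * a 1%nat + - d1 * a O + (- e0 * b 1%nat + - e1 * b O))).
      ring. }
    rewrite HS in Ht. rewrite !S_INR in Ht. lra.
Qed.

(** * The Krawtchouk generating function *)

(* The truncation matters: Stdlib's [Binomial.C N n] is not [0] for [n > N]. *)
Definition finite_coef (c : nat -> R) (N n : nat) : R :=
  if Nat.leb n N then c n else 0.

Lemma is_pseries_finite (c : nat -> R) (N : nat) (w : R) :
  is_pseries (finite_coef c N) w (sum_f_R0 (fun n => c n * w ^ n) N).
Proof.
  apply is_pseries_R. unfold is_series.
  apply filterlim_ext_loc with (fun _ => sum_f_R0 (fun n => c n * w ^ n) N);
    [|apply filterlim_const].
  exists N. intros m Hm. rewrite sum_n_Reals.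
  induction Hm as [|m Hm IH].
  - apply sum_eq. intros i Hi. unfold finite_coef.
    now rewrite (proj2 (Nat.leb_le i N) Hi).
  - simpl. rewrite <- IH. unfold finite_coef.
    rewrite (proj2 (Nat.leb_gt (S m) N)) by lia. ring.
Qed.

Definition krawtchouk_coef (K : nat -> nat -> R -> nat -> R) (x : nat) (p : R)
  (N : nat) : nat -> R :=
  finite_coef (fun n => Binomial.C N n * K n x p N) N.

Lemma is_derive_factor_pow (c w : R) (m : nat) :
  is_derive (fun v => (1 + c * v) ^ m) w (INR m * c * (1 + c * w) ^ pred m).
Proof. auto_derive; trivial. ring. Qed.

(** The factor [INR m] covers [m = 0], where [pred] does not lower the exponent. *)
Lemma pow_pred_mult (y : R) (m : nat) : INR m * y ^ pred m * y = INR m * y ^ m.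
Proof. destruct m; simpl; ring. Qed.

(** The generating function has logarithmic derivative [-q x / (1 - q w) + (N - x) / (1 + w)].
    Multiplied by [(1 - q w) (1 + w) = 1 + (1 - q) w - q w^2], this becomes
    [N - (1 + q) x - q N w]. *)
Lemma krawtchouk_recurrence (K : nat -> nat -> R -> nat -> R)
  (HK : is_krawtchouk K) (p : R) (Hp : p <> 0) (N x : nat) (HxN : (x <= N)%nat) :
  let q := (1 - p) / p in
  let a := krawtchouk_coef K x p N in
  a O = 1 /\
  a 1%nat = (INR N - (1 + q) * INR x) * a O /\
  forall k : nat,
    (INR k + 2) * a (S (S k)) + (1 - q) * (INR k + 1) * a (S k) - q * INR k * a k =
    (INR N - (1 + q) * INR x) * a (S k) - q * INR N * a k.
Proof.
  intros q a.
  pose (g := fun w => (1 + - q * w) ^ x * (1 + 1 * w) ^ (N - x)).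
  assert (Ha : forall w, is_pseries a w (g w)).
  { intros w. unfold g.
    replace ((1 + - q * w) ^ x * (1 + 1 * w) ^ (N - x)) with
      ((1 - (1 - p) / p * w) ^ x * (1 + w) ^ (N - x)) by (f_equal; f_equal; unfold q; ring).
    rewrite (HK p N x Hp HxN w). apply is_pseries_finite. }
  split.
  { transitivity (g 0).
    - rewrite <- (is_pseries_unique _ _ _ (Ha 0)). symmetry. apply PSeries_0.
    - unfold g. rewrite !Rmult_0_r, Rplus_0_r, !pow1. ring. }
  assert (HNx : INR (N - x) = INR N - INR x) by (now apply minus_INR).
  (* The equation is real, so the coupling coefficients are 0 and [g] itself fills the place of the
     second function. *)
  destruct (pseries_ode_recurrence a a g g
    (fun w => (INR x * - q * (1 + - q * w) ^ pred x) * (1 + 1 * w) ^ (N - x) +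
              (1 + - q * w) ^ x * (INR (N - x) * 1 * (1 + 1 * w) ^ pred (N - x)))
    1 (1 - q) (- q) (INR N - (1 + q) * INR x) (- q * INR N) 0 0) as [H1 H2]; auto.
  - lra.
  - intros w _. unfold g.
    apply @is_derive_mult with (f := fun v => (1 + - q * v) ^ x); try apply is_derive_factor_pow.
    intros; apply Rmult_comm.
  - intros w _. unfold g.
    (* Each lowered power is paired with its missing factor, which also covers the exponents 0 and
       the zeros of the two factors. *)
    transitivity
     (- q * (INR x * (1 + - q * w) ^ pred x * (1 + - q * w)) * (1 + 1 * w) ^ (N - x) * (1 + 1 * w)
     + (1 + - q * w) ^ x * (1 + - q * w) *
       (INR (N - x) * (1 + 1 * w) ^ pred (N - x) * (1 + 1 * w))); [ring|].
    rewrite !pow_pred_mult, HNx. ring.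
  - split; [lra|]. intros k. specialize (H2 k). lra.
Qed.

(** * The Laguerre generating function *)

Lemma is_series_Re_Im (c : nat -> C) (l : C)
  (Hc : is_series (K := C_AbsRing) (V := C_NormedModule) c l) :
  is_series (fun n => Re (c n)) (Re l) /\ is_series (fun n => Im (c n)) (Im l).
Proof.
  assert (HRe : forall n, sum_n (fun k => Re (c k)) n = Re (sum_n (G := C_AbelianMonoid) c n)).
  { induction n as [|n IH]; [now rewrite !sum_O|]. rewrite !sum_Sn, IH. reflexivity. }
  assert (HIm : forall n, sum_n (fun k => Im (c k)) n = Im (sum_n (G := C_AbelianMonoid) c n)).
  { induction n as [|n IH]; [now rewrite !sum_O|]. rewrite !sum_Sn, IH. reflexivity. }
  split; intros P [eps HP].
  - destruct (Hc (fun z => ball (Re l) eps (Re z))) as [N HN].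
    { exists eps. intros y Hy. exact (proj1 Hy). }
    exists N. intros n Hn. apply HP. rewrite HRe. now apply HN.
  - destruct (Hc (fun z => ball (Im l) eps (Im z))) as [N HN].
    { exists eps. intros y Hy. exact (proj2 Hy). }
    exists N. intros n Hn. apply HP. rewrite HIm. now apply HN.
Qed.

Lemma Cexp_plus (u v : C) : (Cexp (u + v) = Cexp u * Cexp v)%C.
Proof.
  unfold Cexp, Cmult; simpl. rewrite exp_plus, cos_plus, sin_plus.
  apply injective_projections; unfold Re, Im; simpl; ring.
Qed.

(** For real [w] the exponent [-(alpha + 1) ln (1 - w) - w z / (1 - w)] of the generating function
    is real-linear in [(alpha + 1, z)], so one real formula gives both its real and its imaginary
    part. *)
Definition laguerre_exponent (a z w : R) : R :=
  (- a) * ln (1 - w) - w * z / (1 - w).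

(** Here [1 - w] is a positive real, so its logarithm has argument 0, and the two exponentials merge
    into one. *)
Lemma laguerre_generating_real (alpha z : C) (w : R) (Hw : Rabs w < 1) :
  (Cpower_right (1 - RtoC w) (- alpha - 1) * Cexp (- RtoC w * z / (1 - RtoC w)))%C =
  Cexp (laguerre_exponent (Re alpha + 1) (Re z) w, laguerre_exponent (Im alpha) (Im z) w).
Proof.
  apply Rabs_def2 in Hw.
  unfold Cpower_right. rewrite <- Cexp_plus. f_equal.
  replace (Clog_right (1 - RtoC w)) with (RtoC (ln (1 - w))).
  2:{ unfold Clog_right. rewrite <- RtoC_minus, Cmod_R, Rabs_pos_eq by lra.
      simpl. unfold Rdiv. now rewrite Rmult_0_l, atan_0. }
  unfold Cdiv. rewrite <- RtoC_minus, <- RtoC_inv by lra.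
  unfold laguerre_exponent, Rdiv.
  destruct alpha as [a1 a2], z as [z1 z2].
  unfold Cmult, Cplus, Cminus, Copp, RtoC; simpl.
  f_equal; ring.
Qed.

Lemma is_derive_laguerre_exponent (a z w : R) (Hw : w < 1) :
  is_derive (laguerre_exponent a z) w ((a * (1 - w) - z) / (1 - w) ^ 2).
Proof. unfold laguerre_exponent. auto_derive; [lra|]. field. lra. Qed.

(** The generating function [G = g + i h], restricted to real [w], satisfies [(1 - w)^2 G' = (alpha
    + 1 - z - (alpha + 1) w) G]. Real [w] already determine the coefficients, so the real and
    imaginary parts are treated as two coupled real equations. *)
Lemma laguerre_recurrence (L : nat -> C -> C -> C) (HL : is_laguerre L)
  (alpha z : C) :
  L O alpha z = 1%C /\
  (L 1%nat alpha z = (alpha + 1 - z) * L O alpha z)%C /\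
  forall k : nat,
    ((INR k + 2) * L (S (S k)) alpha z - 2 * (INR k + 1) * L (S k) alpha z
       + INR k * L k alpha z =
     (alpha + 1 - z) * L (S k) alpha z - (alpha + 1) * L k alpha z)%C.
Proof.
  pose (a := fun n => Re (L n alpha z)).
  pose (b := fun n => Im (L n alpha z)).
  pose (A := laguerre_exponent (Re alpha + 1) (Re z)).
  pose (B := laguerre_exponent (Im alpha) (Im z)).
  pose (g := fun w => exp (A w) * cos (B w)).
  pose (h := fun w => exp (A w) * sin (B w)).
  assert (Hab : forall w, Rabs w < 1 -> is_pseries a w (g w) /\ is_pseries b w (h w)).
  { intros w Hw.
    assert (HC : Cmod (RtoC w) < 1) by (now rewrite Cmod_R).
    pose proof (HL alpha z (RtoC w) HC) as Hs.
    rewrite laguerre_generating_real in Hs by exact Hw.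
    destruct (is_series_Re_Im _ _ Hs) as [HRe HIm].
    split; apply is_pseries_R.
    - apply is_series_ext with (2 := HRe). intros n.
      now rewrite <- RtoC_pow, re_scal_r.
    - apply is_series_ext with (2 := HIm). intros n.
      now rewrite <- RtoC_pow, im_scal_r. }
  assert (HA : forall w, Rabs w < 1 ->
    is_derive A w (((Re alpha + 1) * (1 - w) - Re z) / (1 - w) ^ 2)).
  { intros w Hw. apply Rabs_def2 in Hw. apply is_derive_laguerre_exponent. lra. }
  assert (HB : forall w, Rabs w < 1 ->
    is_derive B w ((Im alpha * (1 - w) - Im z) / (1 - w) ^ 2)).
  { intros w Hw. apply Rabs_def2 in Hw. apply is_derive_laguerre_exponent. lra. }
  pose (dA := fun w => ((Re alpha + 1) * (1 - w) - Re z) / (1 - w) ^ 2).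
  pose (dB := fun w => (Im alpha * (1 - w) - Im z) / (1 - w) ^ 2).
  (* Real part: the product of the two imaginary parts enters with a minus sign, hence the signs of
     the last two coefficients. *)
  destruct (pseries_ode_recurrence a b g h (fun w => dA w * g w - dB w * h w) 1 (-2) 1
    (Re alpha + 1 - Re z) (- (Re alpha + 1)) (- (Im alpha - Im z)) (Im alpha))
    as [Ha1 HaS].
  { lra. }
  { apply Hab. }
  { intros w Hw. now apply Hab. }
  { intros w Hw. unfold g, h. specialize (HA w Hw). specialize (HB w Hw).
    auto_derive.
    - split; [now exists (dA w) | split; [now exists (dB w) | trivial]].
    - change (Derive (fun v => A v) w) with (Derive A w).
      change (Derive (fun v => B v) w) with (Derive B w).
      rewrite (is_derive_unique _ _ _ HA), (is_derive_unique _ _ _ HB).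
      unfold dA, dB. ring. }
  { intros w Hw. apply Rabs_def2 in Hw. unfold dA, dB. field. lra. }
  (* Imaginary part: [g] and [h] change roles and the coupling changes sign. *)
  destruct (pseries_ode_recurrence b a h g (fun w => dA w * h w + dB w * g w) 1 (-2) 1
    (Re alpha + 1 - Re z) (- (Re alpha + 1)) (Im alpha - Im z) (- Im alpha))
    as [Hb1 HbS].
  { lra. }
  { intros w Hw. now apply Hab. }
  { apply Hab. }
  { intros w Hw. unfold g, h. specialize (HA w Hw). specialize (HB w Hw).
    auto_derive.
    - split; [now exists (dA w) | split; [now exists (dB w) | trivial]].
    - change (Derive (fun v => A v) w) with (Derive A w).
      change (Derive (fun v => B v) w) with (Derive B w).
      rewrite (is_derive_unique _ _ _ HA), (is_derive_unique _ _ _ HB).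
      unfold dA, dB. ring. }
  { intros w Hw. apply Rabs_def2 in Hw. unfold dA, dB. field. lra. }
  assert (HLab : forall n, L n alpha z = (a n, b n)).
  { intros n. unfold a, b. now destruct (L n alpha z). }
  repeat split.
  - assert (H0 : Rabs 0 < 1) by (rewrite Rabs_R0; lra).
    destruct (Hab 0 H0) as [Ha0 Hb0].
    apply is_pseries_unique in Ha0, Hb0. rewrite PSeries_0 in Ha0, Hb0.
    rewrite HLab, Ha0, Hb0. unfold g, h, A, B, laguerre_exponent.
    rewrite Rminus_0_r, ln_1. unfold Rdiv.
    rewrite !Rmult_0_r, !Rmult_0_l, Rminus_0_r, exp_0, cos_0, sin_0.
    unfold RtoC. f_equal; ring.
  - rewrite !HLab. apply injective_projections; simpl.
    + rewrite Ha1. destruct alpha, z; simpl. ring.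
    + rewrite Hb1. destruct alpha, z; simpl. ring.
  - intros k. rewrite !HLab. specialize (HaS k). specialize (HbS k).
    destruct alpha as [al1 al2], z as [z1 z2]; simpl in *.
    apply injective_projections; simpl; lra.
Qed.

(** * Order estimates in powers of [N] *)

Local Notation Npow k := (fun N : nat => INR N ^ k).

Lemma is_bigO_ext_loc (u1 u2 : nat -> C) (v : nat -> R)
  (Hu : eventually (fun N => u1 N = u2 N)) (H : is_bigO u1 v) : is_bigO u2 v.
Proof.
  destruct H as [M H]. exists M.
  generalize (filter_and _ _ Hu H). apply filter_imp.
  intros N [<- HN]. exact HN.
Qed.

Lemma is_bigO_plus (u1 u2 : nat -> C) (v : nat -> R)
  (H1 : is_bigO u1 v) (H2 : is_bigO u2 v) : is_bigO (fun N => u1 N + u2 N)%C v.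
Proof.
  destruct H1 as [M1 H1], H2 as [M2 H2]. exists (M1 + M2).
  generalize (filter_and _ _ H1 H2). apply filter_imp.
  intros N [HN1 HN2]. pose proof (Cmod_triangle (u1 N) (u2 N)). lra.
Qed.

Lemma is_bigO_mult (u1 u2 : nat -> C) (v1 v2 : nat -> R)
  (H1 : is_bigO u1 v1) (H2 : is_bigO u2 v2) :
  is_bigO (fun N => u1 N * u2 N)%C (fun N => v1 N * v2 N).
Proof.
  destruct H1 as [M1 H1], H2 as [M2 H2]. exists (M1 * M2).
  generalize (filter_and _ _ H1 H2). apply filter_imp.
  intros N [HN1 HN2]. rewrite Cmod_mult, Rabs_mult.
  replace (M1 * M2 * (Rabs (v1 N) * Rabs (v2 N)))
    with ((M1 * Rabs (v1 N)) * (M2 * Rabs (v2 N))) by ring.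
  apply Rmult_le_compat; auto using Cmod_ge_0.
Qed.

Lemma is_bigO_scal (c : C) (u : nat -> C) (v : nat -> R) (H : is_bigO u v) :
  is_bigO (fun N => c * u N)%C v.
Proof.
  destruct H as [M H]. exists (Cmod c * M). revert H. apply filter_imp.
  intros N HN. rewrite Cmod_mult, Rmult_assoc.
  apply Rmult_le_compat_l; auto using Cmod_ge_0.
Qed.

Lemma is_bigO_Npow (k : nat) : is_bigO (fun N => RtoC (INR N ^ k)) (Npow k).
Proof. exists 1. exists O. intros N _. rewrite Cmod_R. lra. Qed.

Lemma is_bigO_Npow_S (u : nat -> C) (k : nat) (H : is_bigO u (Npow k)) :
  is_bigO u (Npow (S k)).
Proof.
  destruct H as [M [N0 H]]. exists M. exists (max 1 N0). intros N HN.
  specialize (H N ltac:(lia)).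
  assert (HN1 : 1 <= INR N) by (change 1 with (INR 1); apply le_INR; lia).
  (* No sign is assumed for [M]; since the modulus is nonnegative, so is the bound, and a factor
     [INR N >= 1] can only enlarge it. *)
  pose proof (Cmod_ge_0 (u N)).
  rewrite <- tech_pow_Rmult, Rabs_mult, (Rabs_pos_eq (INR N)) by lra. nra.
Qed.

Lemma is_bigO_mult_N (u : nat -> C) (k : nat) (H : is_bigO u (Npow k)) :
  is_bigO (fun N => RtoC (INR N) * u N)%C (Npow (S k)).
Proof.
  pose proof (is_bigO_mult _ _ _ _ (is_bigO_Npow 1) H) as H1.
  destruct H1 as [M H1]. exists M. revert H1. apply filter_imp.
  intros N HN. now rewrite pow_1 in HN.
Qed.

Lemma is_bigO_of_mult_N (u : nat -> C) (v : nat -> R)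
  (H : is_bigO (fun N => RtoC (INR N) * u N)%C v) : is_bigO u v.
Proof.
  destruct H as [M [N0 H]]. exists M. exists (max 1 N0). intros N HN.
  specialize (H N ltac:(lia)).
  assert (HN1 : 1 <= INR N) by (change 1 with (INR 1); apply le_INR; lia).
  pose proof (Cmod_ge_0 (u N)).
  rewrite Cmod_mult, Cmod_R, Rabs_pos_eq in H by lra. nra.
Qed.

(** Dropping the factor [N] weakens the error bound to [O(N^k)], the order of the leading term
    itself. *)
Lemma is_bigO_leading (u : nat -> C) (l : C) (k : nat)
  (H : is_bigO (fun N => RtoC (INR N) * (u N - l * RtoC (INR N ^ k)))%C (Npow k)) :
  is_bigO u (Npow k).
Proof.
  apply is_bigO_ext_loc with
    (fun N => (u N - l * RtoC (INR N ^ k)) + l * RtoC (INR N ^ k))%C.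
  { exists O. intros N _. ring. }
  apply is_bigO_plus.
  - now apply is_bigO_of_mult_N.
  - apply is_bigO_scal, is_bigO_Npow.
Qed.

(** * Leading term of a solution of the recurrence *)

(* The error [O(N^(k-1))] is written as [N * error = O(N^k)], which keeps the
   exponents in [nat] at [k = 0]. *)
Lemma recurrence_asymptotics (u : nat -> nat -> C) (d c1 c2 : C) (s : nat -> C)
  (Hs : is_bigO s (Npow 1))
  (Hu : eventually (fun N : nat =>
     u N O = 1%C /\ (u N 1%nat = (RtoC (INR N) + d) * u N O)%C /\
     forall k : nat,
       ((INR k + 2) * u N (S (S k)) + c1 * (INR k + 1) * u N (S k)
          + c2 * INR k * u N k =
        (RtoC (INR N) + d) * u N (S k) + s N * u N k)%C))
  (k : nat) :
  is_bigO (fun N => RtoC (INR N) * (u N k - RtoC (/ INR (fact k)) * RtoC (INR N ^ k)))%C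
    (Npow k).
Proof.
  (* The recurrence reaches back two indices, so the induction carries two consecutive estimates. *)
  enough (H : forall j,
    is_bigO (fun N => RtoC (INR N) * (u N j - RtoC (/ INR (fact j)) * RtoC (INR N ^ j)))%C
      (Npow j) /\
    is_bigO (fun N => RtoC (INR N) * (u N (S j) -
        RtoC (/ INR (fact (S j))) * RtoC (INR N ^ S j)))%C (Npow (S j)))
    by apply H.
  clear k. induction j as [|k [IH0 IH1]]; split.
  (* At index 0 the error vanishes; at index 1 it is the constant [d]. *)
  - apply is_bigO_ext_loc with (fun N => 0 * RtoC (INR N ^ 0))%C.
    + revert Hu. apply filter_imp. intros N [-> _]. simpl. rewrite Rinv_1. ring.
    + apply is_bigO_scal, is_bigO_Npow.
  - apply is_bigO_ext_loc with (fun N => d * RtoC (INR N ^ 1))%C.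
    + revert Hu. apply filter_imp. intros N [H0 [-> _]]. rewrite H0.
      simpl. rewrite Rinv_1, Rmult_1_r. ring.
    + apply is_bigO_scal, is_bigO_Npow.
  - exact IH1.
  - pose proof (is_bigO_leading (fun N => u N k) _ k IH0) as HO0.
    pose proof (is_bigO_leading (fun N => u N (S k)) _ (S k) IH1) as HO1.
    (* The recurrence is solved for the term of index [k + 2]. In [N * u N (S k)] the leading part
       yields [N^(k+2) / (k+2)!] after division by [k + 2], leaving [N] times the previous error;
       all other terms are [O(N^(k+1))] before the factor [N]. *)
    apply is_bigO_ext_loc with (fun N =>
      RtoC (/ (INR k + 2)) *
      (RtoC (INR N) * (RtoC (INR N) *
          (u N (S k) - RtoC (/ INR (fact (S k))) * RtoC (INR N ^ S k))) +
       RtoC (INR N) * ((d - c1 * (INR k + 1)) * u N (S k) +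
          (s N * u N k + (- (c2 * INR k)) * u N k))))%C.
    + revert Hu. apply filter_imp. intros N [_ [_ H]]. specialize (H k).
      assert (Hk : (RtoC (INR k) + 2)%C <> 0%C).
      { rewrite <- RtoC_plus. intros E. apply RtoC_inj in E.
        pose proof (pos_INR k). lra. }
      assert (HuS : u N (S (S k)) = (RtoC (/ (INR k + 2)) *
        ((RtoC (INR N) + d) * u N (S k) + s N * u N k - c1 * (INR k + 1) * u N (S k)
          - c2 * INR k * u N k))%C).
      { rewrite <- H. rewrite RtoC_inv, RtoC_plus by (pose proof (pos_INR k); lra).
        field. exact Hk. }
      rewrite HuS.
      replace (/ INR (fact (S (S k)))) with (/ (INR k + 2) * / INR (fact (S k))).
      2:{ rewrite (fact_simpl (S k)), mult_INR, Rinv_mult, !S_INR.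
          f_equal. f_equal. ring. }
      rewrite <- (tech_pow_Rmult (INR N) (S k)), !RtoC_mult. ring.
    + apply is_bigO_scal, is_bigO_plus.
      * now apply is_bigO_mult_N.
      * apply is_bigO_mult_N, is_bigO_plus; [now apply is_bigO_scal|].
        apply is_bigO_plus; [|now apply is_bigO_scal, is_bigO_Npow_S].
        pose proof (is_bigO_mult _ _ _ _ Hs HO0) as HM.
        destruct HM as [M HM]. exists M. revert HM. apply filter_imp.
        intros N HN. now rewrite pow_1 in HN.
Qed.

(** * Cancellation of the leading terms *)

Theorem mainTheorem5
  (K : nat -> nat -> R -> nat -> R) (HK : is_krawtchouk K)
  (L : nat -> C -> C -> C) (HL : is_laguerre L)
  (n x : nat) (alpha : C) (p : R) (Hp : 0 < p < 1) :
  let q := (1 - p) / p in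
  let xi := fun N : nat =>
    (alpha + 1 - RtoC (INR N) + (1 + RtoC q) * RtoC (INR x))%C in
  is_bigO
    (fun N : nat =>
       (RtoC (Binomial.C N n * K n x p N) - L n alpha (xi N))%C)
    (fun N : nat => powerRZ (INR N) (Z.of_nat n - 1)).
Proof.
  intros q xi.
  (* Both recurrences have [N + d] as coefficient of the term of index [k + 1]: for Laguerre this is
     [alpha + 1 - xi N]. *)
  pose (d := (- ((1 + RtoC q) * RtoC (INR x)))%C).
  assert (HKn := recurrence_asymptotics
    (fun N k => RtoC (krawtchouk_coef K x p N k)) d (1 - RtoC q) (- RtoC q)
    (fun N => - RtoC q * RtoC (INR N ^ 1))%C
    (is_bigO_scal _ _ _ (is_bigO_Npow 1))).
  (* Here the last coefficient is constant in [N]; its bound [O(1)] is raised to [O(N)]. *)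
  assert (HLn := recurrence_asymptotics
    (fun N k => L k alpha (xi N)) d (- (2)) 1
    (fun N => - (alpha + 1) * RtoC (INR N ^ 0))%C
    (is_bigO_Npow_S _ _ (is_bigO_scal _ _ _ (is_bigO_Npow 0)))).
  specialize (fun H => HKn H n). specialize (fun H => HLn H n).
  lapply HKn; clear HKn; [intros HKn|].
  (* The generating function is available only from [N = x] on. *)
  2:{ exists x. intros N HN.
      destruct (krawtchouk_recurrence K HK p ltac:(lra) N x HN) as [H0 [H1 H2]].
      fold q in H1, H2. unfold d.
      split; [now rewrite H0 | split].
      - rewrite H1, RtoC_mult, RtoC_minus, RtoC_mult, RtoC_plus. ring.
      - intros k. specialize (H2 k). apply (f_equal RtoC) in H2.
        rewrite !RtoC_minus, !RtoC_plus, !RtoC_mult, !RtoC_minus, !RtoC_mult,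
          !RtoC_plus in H2.
        rewrite pow_1.
        replace (- RtoC q * RtoC (INR k))%C with (- (RtoC q * RtoC (INR k)))%C by ring.
        transitivity (((RtoC (INR N) - (1 + RtoC q) * RtoC (INR x)) *
          RtoC (krawtchouk_coef K x p N (S k)) -
          RtoC q * RtoC (INR N) * RtoC (krawtchouk_coef K x p N k))%C); [|ring].
        rewrite <- H2. ring. }
  lapply HLn; clear HLn; [intros HLn|].
  2:{ exists O. intros N _.
      destruct (laguerre_recurrence L HL alpha (xi N)) as [H0 [H1 H2]].
      unfold d. split; [exact H0 | split].
      - rewrite H1. unfold xi. ring.
      - intros k. specialize (H2 k).
        transitivity ((alpha + 1 - xi N) * L (S k) alpha (xi N)
          - (alpha + 1) * L k alpha (xi N))%C.
        + rewrite <- H2. ring.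
        + simpl (INR N ^ 0). unfold xi. ring. }
  apply (is_bigO_scal (- (1))) in HLn.
  destruct (is_bigO_plus _ _ _ HKn HLn) as [M [N0 HM]].
  (* The bound 1 permits division by [INR N], and [n] makes the truncated coefficient the genuine
     one. *)
  exists M. exists (max (max 1 n) N0). intros N HN.
  specialize (HM N ltac:(lia)).
  assert (HN1 : 1 <= INR N) by (change 1 with (INR 1); apply le_INR; lia).
  unfold krawtchouk_coef, finite_coef in HM.
  rewrite (proj2 (Nat.leb_le n N)) in HM by lia.
  set (D := (RtoC (Binomial.C N n * K n x p N) - L n alpha (xi N))%C).
  (* The two terms [N^n / n!] cancel here, leaving [N] times the difference. *)
  match type of HM with Cmod ?z <= _ =>
    replace z with (RtoC (INR N) * D)%C in HM by (unfold D; ring) end.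
  rewrite Cmod_mult, Cmod_R, !Rabs_pos_eq in HM by (try apply pow_le; lra).
  (* The exponent is -1 when [n = 0], so the power is rewritten as a quotient. *)
  assert (HP : powerRZ (INR N) (Z.of_nat n - 1) = INR N ^ n / INR N).
  { unfold Z.sub. rewrite powerRZ_add by lra.
    rewrite <- pow_powerRZ. simpl. field. lra. }
  rewrite HP, Rabs_pos_eq.
  - apply Rmult_le_reg_l with (INR N); [lra|].
    replace (INR N * (M * (INR N ^ n / INR N))) with (M * INR N ^ n) by (field; lra).
    exact HM.
  - apply Rdiv_le_0_compat; [apply pow_le; lra | lra].
Qed.
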